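(* Let $\mathcal{A}\in\mathbb{R}^{I\times J\times K}$, let the positive integer $R$ be an upper bound of $\mathrm{rank}(\mathcal{A})$, let $\lambda>0$, and let $s>1$. Let $(\mathbf{X}^n,\mathbf{Y}^n,\mathbf{Z}^n,\bm{\alpha}^n)_{n\in\mathbb{N}}$ and $(d_n,e_n,f_n,\eta_n)_{n\in\mathbb{N}}$ be generated by the LRAT algorithm with parameters $R,\lambda,s$. Then for every $n\in\mathbb{N}$: \begin{align*} \Psi(\mathbf{X}^n,\mathbf{Y}^n,\mathbf{Z}^n,\bm{\alpha}^n)-\Psi(\mathbf{X}^{n+1},\mathbf{Y}^n,\mathbf{Z}^n,\bm{\alpha}^n)&\geq\tfrac{1}{2}(s-1)d_n\|\mathbf{X}^n-\mathbf{X}^{n+1}\|_F^2,\\ \Psi(\mathbf{X}^{n+1},\mathbf{Y}^n,\mathbf{Z}^n,\bm{\alpha}^n)-\Psi(\mathbf{X}^{n+1},\mathbf{Y}^{n+1},\mathbf{Z}^n,\bm{\alpha}^n)&\geq\tfrac{1}{2}(s-1)e_n\|\mathbf{Y}^n-\mathbf{Y}^{n+1}\|_F^2,\\ \Psi(\mathbf{X}^{n+1},\mathbf{Y}^{n+1},\mathbf{Z}^n,\bm{\alpha}^n)-\Psi(\mathbf{X}^{n+1},\mathbf{Y}^{n+1},\mathbf{Z}^{n+1},\bm{\alpha}^n)&\geq\tfrac{1}{2}(s-1)f_n\|\mathbf{Z}^n-\mathbf{Z}^{n+1}\|_F^2,\\ \Psi(\mathbf{X}^{n+1},\mathbf{Y}^{n+1},\mathbf{Z}^{n+1},\bm{\alpha}^n)-\Psi(\mathbf{X}^{n+1},\mathbf{Y}^{n+1},\mathbf{Z}^{n+1},\bm{\alpha}^{n+1})&\geq\tfrac{1}{2}(s-1)\eta_n\|\bm{\alpha}^n-\bm{\alpha}^{n+1}\|_F^2.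 \end{align*}
   Context: Notation. For $\mathbf{X}=(\mathbf{x}_1,\dots,\mathbf{x}_R)\in\mathbb{R}^{I\times R}$, $\mathbf{Y}=(\mathbf{y}_1,\dots,\mathbf{y}_R)\in\mathbb{R}^{J\times R}$, $\mathbf{Z}=(\mathbf{z}_1,\dots,\mathbf{z}_R)\in\mathbb{R}^{K\times R}$ and a row vector $\bm{\alpha}=(\alpha_1,\dots,\alpha_R)\in\mathbb{R}^R$, set $[\bm{\alpha};\mathbf{X},\mathbf{Y},\mathbf{Z}]_R=\sum_{r=1}^R\alpha_r\,\mathbf{x}_r\circ\mathbf{y}_r\circ\mathbf{z}_r$, where $\mathbf{x}\circ\mathbf{y}\circ\mathbf{z}$ is the tensor with entries $x_iy_jz_k$. The rank of $\mathcal{A}$ is the minimal number of such outer products summing to $\mathcal{A}$. $\|\cdot\|_F$ is the Frobenius norm (Euclidean norm for vectors), $\|\bm{\alpha}\|_1=\sum_r|\alpha_r|$. Let $S_1,S_2,S_3$ be the sets of matrices in $\mathbb{R}^{I\times R},\mathbb{R}^{J\times R},\mathbb{R}^{K\times R}$, respectively, all of whose columns have Euclidean norm one, and $\delta_S$ the indicator function ($0$ on $S$, $+\infty$ off $S$). Put $f(\mathbf{X},\mathbf{Y},\mathbf{Z},\bm{\alpha})=\frac12\|\mathcal{A}-[\bm{\alpha};\mathbf{X},\mathbf{Y},\mathbf{Z}]_R\|_F^2$, $g(\bm{\alpha})=\lambda\|\bm{\alpha}\|_1$ and $$\Psi(\mathbf{X},\mathbf{Y},\mathbf{Z},\bm{\alpha})=f(\mathbf{X},\mathbf{Y},\mathbf{Z},\bm{\alpha})+g(\bm{\alpha})+\delta_{S_1}(\mathbf{X})+\delta_{S_2}(\mathbf{Y})+\delta_{S_3}(\mathbf{Z}).$$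 The Khatri-Rao product is $\mathbf{X}\odot\mathbf{Y}=(\mathbf{x}_1\otimes\mathbf{y}_1,\dots,\mathbf{x}_R\otimes\mathbf{y}_R)$ with $\otimes$ the Kronecker product. With $\mathbf{D}_{\bm\alpha}=\mathrm{diag}(\alpha_1,\dots,\alpha_R)$, put $\mathbf{U}=\mathbf{D}_{\bm\alpha}(\mathbf{Z}\odot\mathbf{Y})^T$, $\mathbf{V}=\mathbf{D}_{\bm\alpha}(\mathbf{Z}\odot\mathbf{X})^T$, $\mathbf{W}=\mathbf{D}_{\bm\alpha}(\mathbf{Y}\odot\mathbf{X})^T$, and let $\mathbf{Q}\in\mathbb{R}^{R\times IJK}$ be the matrix whose $r$-th row is the vectorization of $\mathbf{x}_r\circ\mathbf{y}_r\circ\mathbf{z}_r$. LRAT algorithm. Input: $\mathcal{A}$, $R$ (upper bound of $\mathrm{rank}(\mathcal{A})$), $\lambda$, $s>1$. Start from $(\mathbf{X}^0,\mathbf{Y}^0,\mathbf{Z}^0,\bm{\alpha}^0)$ with $\mathbf{X}^0\in S_1$, $\mathbf{Y}^0\in S_2$, $\mathbf{Z}^0\in S_3$. For $n=0,1,2,\dots$: (1) $\mathbf{U}^n$ is $\mathbf{U}$ computed from $(\bm{\alpha}^n,\mathbf{Y}^n,\mathbf{Z}^n)$, $d_n=\max\{\|\mathbf{U}^n{\mathbf{U}^n}^T\|_F,1\}$, $\mathbf{D}^n=\mathbf{X}^n-\frac{1}{sd_n}\nabla_{\mathbf{X}}f(\mathbf{X}^n,\mathbf{Y}^n,\mathbf{Z}^n,\bm{\alpha}^n)$,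 and $\mathbf{X}^{n+1}$ is obtained from $\mathbf{D}^n$ by dividing each column by its Euclidean norm. (2) $\mathbf{V}^n$ is $\mathbf{V}$ computed from $(\bm{\alpha}^n,\mathbf{X}^{n+1},\mathbf{Z}^n)$, $e_n=\max\{\|\mathbf{V}^n{\mathbf{V}^n}^T\|_F,1\}$, $\mathbf{E}^n=\mathbf{Y}^n-\frac{1}{se_n}\nabla_{\mathbf{Y}}f(\mathbf{X}^{n+1},\mathbf{Y}^n,\mathbf{Z}^n,\bm{\alpha}^n)$, and $\mathbf{Y}^{n+1}$ is obtained from $\mathbf{E}^n$ by dividing each column by its norm. (3) $\mathbf{W}^n$ is $\mathbf{W}$ computed from $(\bm{\alpha}^n,\mathbf{X}^{n+1},\mathbf{Y}^{n+1})$, $f_n=\max\{\|\mathbf{W}^n{\mathbf{W}^n}^T\|_F,1\}$, $\mathbf{F}^n=\mathbf{Z}^n-\frac{1}{sf_n}\nabla_{\mathbf{Z}}f(\mathbf{X}^{n+1},\mathbf{Y}^{n+1},\mathbf{Z}^n,\bm{\alpha}^n)$, and $\mathbf{Z}^{n+1}$ is obtained from $\mathbf{F}^n$ by dividing each column by its norm. (4) $\mathbf{Q}^{n+1}$ is $\mathbf{Q}$ computed from $(\mathbf{X}^{n+1},\mathbf{Y}^{n+1},\mathbf{Z}^{n+1})$, $\eta_n=\max\{\|\mathbf{Q}^{n+1}{\mathbf{Q}^{n+1}}^T\|_F,1\}$, $\bm{\beta}^{n+1}=\bm{\alpha}^n-\frac{1}{s\eta_n}\nabla_{\bm{\alpha}}f(\mathbf{X}^{n+1},\mathbf{Y}^{n+1},\mathbf{Z}^{n+1},\bm{\alpha}^n)$,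 and $\bm{\alpha}^{n+1}=\mathcal{S}_{\lambda/(s\eta_n)}(\bm{\beta}^{n+1})$, where $\mathcal{S}_\tau$ is componentwise soft thresholding, $\mathcal{S}_\tau(t)=\mathrm{sgn}(t)\max\{|t|-\tau,0\}$. A sequence generated by the algorithm is understood to be one for which all columns of $\mathbf{D}^n,\mathbf{E}^n,\mathbf{F}^n$ are nonzero, so that the normalizations are defined. *)

(* Defs.v *)
From HB Require Import structures.
From mathcomp Require Import all_boot all_order all_algebra.
From mathcomp Require Import all_classical all_reals all_analysis.
From mathcomp Require Import mxtens.

Set Implicit Arguments.
Unset Strict Implicit.
Unset Printing Implicit Defensive.

Import Order.TTheory GRing.Theory Num.Theory.
Import numFieldNormedType.Exports.

Local Open Scope classical_set_scope.
Local Open Scope ring_scope.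

Notation tensor3 R I J K := {ffun 'I_I * 'I_J * 'I_K -> R}.

Section Tensor.
Context {R : realType} {I J K : nat}.

Definition outer (x : 'cV[R]_I) (y : 'cV[R]_J) (z : 'cV[R]_K) :
    tensor3 R I J K :=
  [ffun t => x t.1.1 0 * y t.1.2 0 * z t.2 0].

Definition sum_of_outer (A : tensor3 R I J K) (r : nat) : Prop :=
  exists (x : 'I_r -> 'cV[R]_I) (y : 'I_r -> 'cV[R]_J) (z : 'I_r -> 'cV[R]_K),
    A = \sum_(k < r) outer (x k) (y k) (z k).

Lemma sum_of_outer_ex (A : tensor3 R I J K) :
  exists r, `[< sum_of_outer A r >].
Proof.
exists #|{: 'I_I * 'I_J * 'I_K}|; apply/asboolP.
pose e (k : 'I_#|{: 'I_I * 'I_J * 'I_K}|) : 'I_I * 'I_J * 'I_K := enum_val k.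
exists (fun k => A (e k) *: delta_mx (e k).1.1 0),
  (fun k => delta_mx (e k).1.2 0), (fun k => delta_mx (e k).2 0).
apply/ffunP => t; rewrite sum_ffunE (bigD1 (enum_rank t)) //= big1 ?addr0.
  by rewrite ffunE /e enum_rankK !mxE !eqxx !mulr1.
move=> k kt; rewrite ffunE !mxE !eqxx !andbT.
have : t != e k by apply: contra kt => /eqP ->; rewrite /e enum_valK.
case: t {kt} => -[i j] l; case: (e k) => -[i' j'] l' /=; rewrite !xpair_eqE.
by case: (i == i'); case: (j == j'); case: (l == l');
  rewrite ?(mulr0, mul0r).
Qed.

Definition tensor_rank (A : tensor3 R I J K) : nat := ex_minn (sum_of_outer_ex A).

Definition tnorm (A : tensor3 R I J K) : R := Num.sqrt (\sum_t A t ^+ 2).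

Definition cp_tensor (L : nat) (alpha : 'rV[R]_L) (X : 'M[R]_(I, L))
    (Y : 'M[R]_(J, L)) (Z : 'M[R]_(K, L)) : tensor3 R I J K :=
  \sum_(r < L) alpha 0 r *: outer (col r X) (col r Y) (col r Z).

(* Row-major ordering; the Gram matrix of vectorized tensors does not depend on
   the ordering. *)
Definition vec_tensor (A : tensor3 R I J K) : 'rV[R]_(I * J * K) :=
  \row_l let: (ij, k) := mxtens_unindex l in A (mxtens_unindex ij, k).

End Tensor.

Section Matrix.
Context {R : realType}.

Definition fnorm m n (A : 'M[R]_(m, n)) : R :=
  Num.sqrt (\sum_i \sum_j A i j ^+ 2).

Definition norm1 n (a : 'rV[R]_n) : R := \sum_r `|a 0 r|.

Definition unit_cols m n : set 'M[R]_(m, n) :=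
  [set X | forall r, fnorm (col r X) = 1].

Definition normalize_cols m n (D : 'M[R]_(m, n)) : 'M[R]_(m, n) :=
  \matrix_(i, r) (D i r / fnorm (col r D)).

Definition nonzero_cols m n (D : 'M[R]_(m, n)) : Prop :=
  forall r, col r D != 0.

Definition khatri_rao m n L (X : 'M[R]_(m, L)) (Y : 'M[R]_(n, L)) :
    'M[R]_(m * n, L) :=
  \matrix_(k, r) tensmx (col r X) (col r Y) k 0.

(* Entrywise directional derivatives along the coordinate directions; ['D_] is
   a junk value where [h] is not differentiable. *)
Definition gradient m n (h : 'M[R]_(m, n) -> R) (X : 'M[R]_(m, n)) :
    'M[R]_(m, n) :=
  \matrix_(i, j) 'D_(delta_mx i j) h X.

Definition soft_threshold (tau t : R) : R :=
  Num.sg t * Num.max (`|t| - tau) 0.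

Definition indicator_fun (T : Type) (S : set T) (x : T) : \bar R :=
  if x \in S then 0%E else +oo%E.

(* The matrix [diag(alpha) (P (.) Q)^T] underlying each of U, V and W. *)
Definition diag_kr m n L (alpha : 'rV[R]_L) (P : 'M[R]_(m, L))
    (Q : 'M[R]_(n, L)) : 'M[R]_(L, m * n) :=
  diag_mx alpha *m (khatri_rao P Q)^T.

Definition step_const m n (U : 'M[R]_(m, n)) : R :=
  Num.max (fnorm (U *m U^T)) 1.

End Matrix.

Section LRAT.
Context {R : realType} {I J K L : nat}.
Variables (A : tensor3 R I J K) (lambda s : R).
Implicit Types (X : 'M[R]_(I, L)) (Y : 'M[R]_(J, L)) (Z : 'M[R]_(K, L))
  (alpha : 'rV[R]_L).

Definition lrat_f X Y Z alpha : R :=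
  2^-1 * tnorm (A - cp_tensor alpha X Y Z) ^+ 2.

Definition lrat_g alpha : R := lambda * norm1 alpha.

Definition Psi X Y Z alpha : \bar R :=
  ((lrat_f X Y Z alpha)%:E + (lrat_g alpha)%:E
   + indicator_fun (@unit_cols R I L) X
   + indicator_fun (@unit_cols R J L) Y
   + indicator_fun (@unit_cols R K L) Z)%E.

Definition matU alpha Y Z := diag_kr alpha Z Y.
Definition matV alpha X Z := diag_kr alpha Z X.
Definition matW alpha X Y := diag_kr alpha Y X.
Definition matQ X Y Z : 'M[R]_(L, I * J * K) :=
  \matrix_(r < L) vec_tensor (outer (col r X) (col r Y) (col r Z)).

Record LRAT_sequence
    (X : nat -> 'M[R]_(I, L)) (Y : nat -> 'M[R]_(J, L))
    (Z : nat -> 'M[R]_(K, L)) (alpha : nat -> 'rV[R]_L)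
    (d e f eta : nat -> R) : Prop := {
  lrat_X0 : unit_cols (X 0%N);
  lrat_Y0 : unit_cols (Y 0%N);
  lrat_Z0 : unit_cols (Z 0%N);
  lrat_d : forall n, d n = step_const (matU (alpha n) (Y n) (Z n));
  lrat_X : forall n,
    let D := X n - (s * d n)^-1 *:
      gradient (fun X' => lrat_f X' (Y n) (Z n) (alpha n)) (X n) in
    nonzero_cols D /\ X n.+1 = normalize_cols D;
  lrat_e : forall n, e n = step_const (matV (alpha n) (X n.+1) (Z n));
  lrat_Y : forall n,
    let E := Y n - (s * e n)^-1 *:
      gradient (fun Y' => lrat_f (X n.+1) Y' (Z n) (alpha n)) (Y n) in
    nonzero_cols E /\ Y n.+1 = normalize_cols E;
  lrat_fn : forall n, f n = step_const (matW (alpha n) (X n.+1) (Y n.+1));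
  lrat_Z : forall n,
    let F := Z n - (s * f n)^-1 *:
      gradient (fun Z' => lrat_f (X n.+1) (Y n.+1) Z' (alpha n)) (Z n) in
    nonzero_cols F /\ Z n.+1 = normalize_cols F;
  lrat_eta : forall n,
    eta n = step_const (matQ (X n.+1) (Y n.+1) (Z n.+1));
  lrat_alpha : forall n,
    let beta := alpha n - (s * eta n)^-1 *:
      gradient (lrat_f (X n.+1) (Y n.+1) (Z n.+1)) (alpha n) in
    alpha n.+1 = map_mx (soft_threshold (lambda / (s * eta n))) beta
}.

End LRAT.

(* Main.v *)
Require Import Defs.
From mathcomp Require Import all_boot all_order all_algebra.
From mathcomp Require Import all_classical all_reals all_analysis.
From mathcomp Require Import mxtens ring lra.

(* With the other blocks fixed, the smooth part of [Psi] is a least-squares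
   function [X |-> 1/2 |B - X M|^2], with [M] one of [U, V, W, Q]. Its
   second-order expansion is exact, and its quadratic term [1/2 |D M|^2] is at
   most [c/2 |D|^2] for [c = max(|M M^T|, 1)]. Each update minimizes the
   linearization plus [s c / 2 |. - X|^2] plus the nonsmooth term, so this model
   does not increase from the current point to the next, and the surplus
   [(s - 1) c / 2 |. - X|^2] bounds the decrease of [Psi]. *)

Set Implicit Arguments.
Unset Strict Implicit.
Unset Printing Implicit Defensive.

Import Order.TTheory GRing.Theory Num.Theory.
Import numFieldNormedType.Exports.

Local Open Scope classical_set_scope.
Local Open Scope ring_scope.

(** * Frobenius inner product and norm inequalities *)

Section Frobenius.
Context {R : realType}.

Definition mxdot m n (A B : 'M[R]_(m, n)) : R := \tr (A *m B^T).

Lemma mxdotE m n (A B : 'M[R]_(m, n)) :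
  mxdot A B = \sum_i \sum_j A i j * B i j.
Proof.
by apply: eq_bigr => i _; rewrite mxE; apply: eq_bigr => j _; rewrite mxE.
Qed.

Lemma mxdotC m n (A B : 'M[R]_(m, n)) : mxdot A B = mxdot B A.
Proof. by rewrite /mxdot -mxtrace_tr trmx_mul trmxK. Qed.

Lemma mxdotDl m n (A B C : 'M[R]_(m, n)) :
  mxdot (A + B) C = mxdot A C + mxdot B C.
Proof. by rewrite /mxdot mulmxDl mxtraceD. Qed.

Lemma mxdotZl m n a (A C : 'M[R]_(m, n)) : mxdot (a *: A) C = a * mxdot A C.
Proof. by rewrite /mxdot -scalemxAl mxtraceZ. Qed.

Lemma mxdotDr m n (A B C : 'M[R]_(m, n)) :
  mxdot C (A + B) = mxdot C A + mxdot C B.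
Proof. by rewrite mxdotC mxdotDl ![mxdot _ C]mxdotC. Qed.

Lemma mxdotZr m n a (A C : 'M[R]_(m, n)) : mxdot C (a *: A) = a * mxdot C A.
Proof. by rewrite mxdotC mxdotZl mxdotC. Qed.

Lemma mxdotNl m n (A C : 'M[R]_(m, n)) : mxdot (- A) C = - mxdot A C.
Proof. by rewrite -scaleN1r mxdotZl mulN1r. Qed.

Lemma mxdotNr m n (A C : 'M[R]_(m, n)) : mxdot C (- A) = - mxdot C A.
Proof. by rewrite -scaleN1r mxdotZr mulN1r. Qed.

Lemma mxdot_mulmxr m n p (A : 'M[R]_(m, n)) (M : 'M[R]_(n, p))
    (N : 'M[R]_(m, p)) : mxdot (A *m M) N = mxdot A (N *m M^T).
Proof. by rewrite /mxdot trmx_mul trmxK mulmxA. Qed.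

Lemma mxdot_delta m n (A : 'M[R]_(m, n)) i j : mxdot A (delta_mx i j) = A i j.
Proof.
rewrite mxdotE (bigD1 i) //= (bigD1 j) //= !mxE !eqxx mulr1 !big1 ?addr0 //.
  by move=> k /negPf ki; apply: big1 => l _; rewrite mxE ki mulr0.
by move=> l /negPf lj; rewrite mxE lj andbF mulr0.
Qed.

Lemma mxdot_col m n (A B : 'M[R]_(m, n)) :
  mxdot A B = \sum_r mxdot (col r A) (col r B).
Proof.
rewrite mxdotE exchange_big; apply: eq_bigr => r _.
by rewrite mxdotE; apply: eq_bigr => i _; rewrite big_ord1 !mxE.
Qed.

Lemma sqr_fnorm m n (A : 'M[R]_(m, n)) : fnorm A ^+ 2 = mxdot A A.
Proof.
rewrite sqr_sqrtr ?mxdotE //.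
by apply: sumr_ge0 => i _; apply: sumr_ge0 => j _; exact: sqr_ge0.
Qed.

Lemma fnorm_ge0 m n (A : 'M[R]_(m, n)) : 0 <= fnorm A.
Proof. exact: sqrtr_ge0. Qed.

Lemma fnorm_eq0 m n (A : 'M[R]_(m, n)) : fnorm A = 0 -> A = 0.
Proof.
move=> A0; have /eqP : fnorm A ^+ 2 = 0 by rewrite A0 expr0n.
rewrite sqr_fnorm mxdotE psumr_eq0 => [/allP H|i _]; last first.
  by apply: sumr_ge0 => j _; rewrite -expr2 sqr_ge0.
apply/matrixP => i j; have := H i (mem_index_enum _).
rewrite psumr_eq0 => [/allP /(_ j (mem_index_enum _))|k _]; last first.
  by rewrite -expr2 sqr_ge0.
by rewrite -expr2 sqrf_eq0 mxE => /eqP.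
Qed.

(** Cauchy-Schwarz: for nonzero norms, the square of [| |B| A - |A| B |] expands to
    [2 |A| |B| (|A| |B| - <A, B>)]. *)
Lemma mxdot_fnorm m n (A B : 'M[R]_(m, n)) : mxdot A B <= fnorm A * fnorm B.
Proof.
have [/fnorm_eq0 ->|A0] := eqVneq (fnorm A) 0.
  by rewrite -[0](scale0r 0) mxdotZl mul0r mulr_ge0 ?fnorm_ge0.
have [/fnorm_eq0 ->|B0] := eqVneq (fnorm B) 0.
  by rewrite -[0](scale0r 0) mxdotZr mul0r mulr_ge0 ?fnorm_ge0.
have AB : 0 < fnorm A * fnorm B.
  by rewrite mulr_gt0 // lt_neqAle fnorm_ge0 eq_sym ?A0 ?B0.
rewrite -(ler_pM2l AB) -subr_ge0.
have := sqr_ge0 (fnorm (fnorm B *: A - fnorm A *: B)).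
rewrite sqr_fnorm mxdotDl !mxdotDr mxdotNl !mxdotNr mxdotNl !(mxdotZl, mxdotZr).
rewrite (mxdotC B A) -!sqr_fnorm; nra.
Qed.

(** Each entry of [A *m B] pairs a row of [A] with a column of [B]. Cauchy-Schwarz bounds its
    square, and the sum of these bounds over rows and columns factors. *)
Lemma fnorm_mulmx m n p (A : 'M[R]_(m, n)) (B : 'M[R]_(n, p)) :
  fnorm (A *m B) <= fnorm A * fnorm B.
Proof.
rewrite -(@ler_pXn2r _ 2) ?nnegrE ?mulr_ge0 ?fnorm_ge0 // exprMn.
rewrite !sqr_fnorm mxdotE (mxdot_col B) mxdotE mulr_suml.
apply: ler_sum => i _; rewrite mulr_sumr; apply: ler_sum => j _.
have -> : (A *m B) i j = mxdot (row i A)^T (col j B).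
  rewrite mxE mxdotE; apply: eq_bigr => k _.
  by rewrite big_ord1 !mxE.
have -> : \sum_k A i k * A i k = mxdot (row i A)^T (row i A)^T.
  by rewrite mxdotE; apply: eq_bigr => k _; rewrite big_ord1 !mxE.
rewrite -expr2 -!sqr_fnorm -exprMn -real_normK ?num_real //.
rewrite ler_pXn2r ?nnegrE ?mulr_ge0 ?fnorm_ge0 //.
(* The lower bound is Cauchy-Schwarz for the negated row. *)
rewrite ler_norml mxdot_fnorm andbT lerNl -mxdotNl.
apply: le_trans (mxdot_fnorm _ _) _.
suff -> : fnorm (- (row i A)^T) = fnorm (row i A)^T by [].
congr Num.sqrt; apply: eq_bigr => k _; apply: eq_bigr => l _.
by rewrite mxE sqrrN.
Qed.

(** [|A M|^2 = <A, A (M M^T)> <= |A|^2 |M M^T|]. *)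
Lemma sqr_fnorm_mulmx m n p (A : 'M[R]_(m, n)) (M : 'M[R]_(n, p)) :
  fnorm (A *m M) ^+ 2 <= step_const M * fnorm A ^+ 2.
Proof.
rewrite sqr_fnorm mxdot_mulmxr -mulmxA.
apply: le_trans (mxdot_fnorm _ _) _.
rewrite mulrC expr2 mulrA; apply: ler_wpM2r; first exact: fnorm_ge0.
apply: le_trans (fnorm_mulmx _ _) _.
by rewrite mulrC ler_wpM2r ?fnorm_ge0 // le_max lexx.
Qed.

Lemma step_const_gt0 m n (M : 'M[R]_(m, n)) : 0 < step_const M.
Proof. by rewrite lt_max ltr01 orbT. Qed.

End Frobenius.

(** * Exact expansion, gradient and descent for least squares *)

Section LeastSquares.
Context {R : realType} {m n p : nat} (B : 'M[R]_(m, p)) (M : 'M[R]_(n, p)).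

Definition lsq (X : 'M[R]_(m, n)) : R := 2^-1 * fnorm (B - X *m M) ^+ 2.

Lemma lsqD X D :
  lsq (X + D) =
  lsq X + mxdot ((X *m M - B) *m M^T) D + 2^-1 * fnorm (D *m M) ^+ 2.
Proof.
rewrite /lsq -mxdotC -mxdot_mulmxr mulmxDl !sqr_fnorm.
rewrite !(mxdotDl, mxdotDr, mxdotNl, mxdotNr).
rewrite (mxdotC (D *m M) B) (mxdotC (D *m M) (X *m M)) (mxdotC (X *m M) B).
by field.
Qed.

(** By the exact expansion, the difference quotient along [delta_mx i j] is [g + t * c] for every
    [t != 0], which tends to [g]. *)
Lemma gradient_lsq X : gradient lsq X = (X *m M - B) *m M^T.
Proof.
apply/matrixP => i j; rewrite mxE; set g := (_ *m _) i j.
set c := 2^-1 * fnorm (delta_mx i j *m M) ^+ 2.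
apply: cvg_lim => //=.
apply: (@cvg_trans _ ((fun t : R => g + t * c) @ 0^')).
  apply: near_eq_cvg; near=> t.
  have t0 : t != 0 by near: t; exact: nbhs_dnbhs_neq.
  rewrite /= [_ *: _ + X]addrC lsqD -scalemxAl !sqr_fnorm mxdotZl !mxdotZr.
  rewrite mxdot_delta -sqr_fnorm -/g /c /GRing.scale /=.
  by field.
suff : (fun t : R => g + t * c) @ 0^' --> g + 0 * c by rewrite mul0r addr0.
apply: cvgD; first exact: cvg_cst.
apply: cvgM; last exact: cvg_cst.
exact: cvg_within.
Unshelve. all: by end_near.
Qed.

(* [u] and [v] are the values of the nonsmooth part at [X] and [X']. *)
Lemma lsq_descent s X X' (u v : R) :
  mxdot (gradient lsq X) (X' - X)
    + 2^-1 * (s * step_const M) * fnorm (X' - X) ^+ 2 + v <= u ->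
  2^-1 * (s - 1) * step_const M * fnorm (X - X') ^+ 2 <=
  lsq X + u - (lsq X' + v).
Proof.
rewrite gradient_lsq => H.
have -> : fnorm (X - X') ^+ 2 = fnorm (X' - X) ^+ 2.
  by rewrite -opprB !sqr_fnorm mxdotNl mxdotNr opprK.
have -> : lsq X' = lsq (X + (X' - X)) by rewrite addrC subrK.
rewrite lsqD; have := sqr_fnorm_mulmx (X' - X) M; lra.
Qed.

End LeastSquares.

(** * Column normalization as a constrained minimization *)

Section UnitColumns.
Context {R : realType} {m n : nat}.
Implicit Types X D G : 'M[R]_(m, n).

Lemma col_normalize_cols D r :
  col r (normalize_cols D) = (fnorm (col r D))^-1 *: col r D.
Proof. by apply/matrixP => i j; rewrite !mxE mulrC. Qed.

Lemma nonzero_cols_fnorm D r : nonzero_cols D -> fnorm (col r D) != 0.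
Proof. by move=> /(_ r); apply: contra => /eqP /fnorm_eq0 ->. Qed.

Lemma normalize_cols_unit D : nonzero_cols D -> unit_cols (normalize_cols D).
Proof.
move=> D0 r; have Dr := nonzero_cols_fnorm r D0; rewrite col_normalize_cols.
apply/eqP; rewrite -(@eqrXn2 _ 2) ?fnorm_ge0 // sqr_fnorm mxdotZl mxdotZr.
by rewrite -sqr_fnorm expr1n mulrA -expr2 -exprMn mulVf ?expr1n.
Qed.

(* The constraint makes [|N - D|^2] affine in [N], so minimality reduces to
   Cauchy-Schwarz on each column. *)
Lemma normalize_cols_prox X G (c : R) : 0 < c -> unit_cols X ->
  let D := X - c^-1 *: G in nonzero_cols D ->
  mxdot G (normalize_cols D - X)
    + 2^-1 * c * fnorm (normalize_cols D - X) ^+ 2 <= 0.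
Proof.
move=> c0 X1 D D0; have N1 := normalize_cols_unit D0.
set N := normalize_cols D in N1 *.
have -> : G = c *: (X - D).
  by rewrite /D opprB addrC subrK scalerA divff ?scale1r // gt_eqF.
have XX : mxdot X X = mxdot N N.
  rewrite !mxdot_col; apply: eq_bigr => r _.
  by rewrite -!sqr_fnorm (X1 r) (N1 r).
have DX : mxdot D X <= mxdot D N.
  rewrite !mxdot_col; apply: ler_sum => r _.
  apply: le_trans (mxdot_fnorm _ _) _; rewrite (X1 r) mulr1.
  rewrite col_normalize_cols mxdotZr -sqr_fnorm expr2 mulKf //.
  exact: nonzero_cols_fnorm.
clearbody N D.
(* Since [|X| = |N|], the left side equals [c (<D, X> - <D, N>)]. *)
rewrite mxdotZl sqr_fnorm !(mxdotDl, mxdotDr, mxdotNl, mxdotNr) (mxdotC N X) XX.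
have := mulr_ge0 (ltW c0) (etrans (subr_ge0 _ _) DX); lra.
Qed.

(** The value [u] is the same at both ends: it stands for the l1 term, which is constant during the
    update of a factor matrix. *)
Lemma lsq_normalize_descent p (B : 'M[R]_(m, p)) (M : 'M[R]_(n, p))
    X (s u : R) : 1 < s -> unit_cols X ->
  let D := X - (s * step_const M)^-1 *: gradient (lsq B M) X in
  nonzero_cols D ->
  2^-1 * (s - 1) * step_const M * fnorm (X - normalize_cols D) ^+ 2 <=
  lsq B M X + u - (lsq B M (normalize_cols D) + u).
Proof.
move=> s1 X1 D D0; apply: lsq_descent; rewrite gerDr.
by apply: normalize_cols_prox => //;
  rewrite mulr_gt0 ?step_const_gt0 ?(lt_trans ltr01).
Qed.

Lemma indicator_unit_cols X :
  unit_cols X -> indicator_fun (@unit_cols R m n) X = 0%E :> \bar R.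
Proof. by move=> X1; rewrite /indicator_fun mem_set. Qed.

End UnitColumns.

(** * Soft thresholding as the proximal map of the l1 norm *)

Section SoftThreshold.
Context {R : realType}.

Lemma soft_threshold_prox (tau b x : R) : 0 <= tau ->
  let y := soft_threshold tau b in
  tau * `|y| + 2^-1 * (y - b) ^+ 2 <= tau * `|x| + 2^-1 * (x - b) ^+ 2.
Proof.
move=> t0 /=; rewrite /soft_threshold.
have x_ge0 := normr_ge0 x; have x_ge := ler_norm x.
have : - x <= `|x| by rewrite -normrN ler_norm.
rewrite -subr_ge0 opprK => Nx; rewrite -subr_ge0 in x_ge.
have [b0|b0|->] := ltgtP b 0.
- rewrite (ltr0_sg b0) (ltr0_norm b0) mulN1r normrN.
  have [|] := leP (- b - tau) 0 => H.
    by rewrite normr0; nra.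
  rewrite gtr0_norm //.
  (* Here [y = b + tau], and the gap is [(x - b - tau)^2 / 2 + tau (|x| + x)]; the case [b > 0]
     mirrors it. *)
  by have := mulr_ge0 t0 Nx; have := sqr_ge0 (x - b - tau); nra.
- rewrite (gtr0_sg b0) (gtr0_norm b0) mul1r.
  have [|] := leP (b - tau) 0 => H.
    by rewrite normr0; nra.
  rewrite gtr0_norm //.
  by have := mulr_ge0 t0 x_ge; have := sqr_ge0 (x - b + tau); nra.
by rewrite sgr0 mul0r normr0; nra.
Qed.

(** The model separates over entries, and completing the square turns each one into [c] times the
    scalar proximal problem centred at [a - g / c] with threshold [lambda / c]. *)
Lemma soft_threshold_norm1 n (a g : 'rV[R]_n) (lambda c : R) :
  0 < lambda -> 0 < c ->
  let a' := map_mx (soft_threshold (lambda / c)) (a - c^-1 *: g) in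
  mxdot g (a' - a) + 2^-1 * c * fnorm (a' - a) ^+ 2 + lambda * norm1 a'
    <= lambda * norm1 a.
Proof.
move=> l0 c0 /=; set a' := map_mx _ _.
rewrite sqr_fnorm !mxdotE !big_ord1 /norm1 !mulr_sumr -!big_split /=.
apply: ler_sum => r _.
have := @soft_threshold_prox (lambda / c) ((a - c^-1 *: g) 0 r) (a 0 r).
have -> : soft_threshold (lambda / c) ((a - c^-1 *: g) 0 r) = a' 0 r.
  by rewrite [RHS]mxE.
move=> /(_ (ltW (divr_gt0 l0 c0))) /=.
have -> : (a' - a) 0 r = a' 0 r - a 0 r by rewrite !mxE.
have -> : (a - c^-1 *: g) 0 r = a 0 r - c^-1 * g 0 r by rewrite !mxE.
move: (a' 0 r) (a 0 r) (g 0 r) => y x z.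
move=> /(ler_wpM2l (ltW c0)).
set p := (X in X <= _ -> _); set q := (X in _ <= X -> _).
(* Both sides carry the same remainder [z^2 / (2 c)] from completing the square, which cancels. *)
have -> : p = lambda * `|y| + (z * (y - x) + 2^-1 * c * ((y - x) * (y - x)))
   + 2^-1 * z ^+ 2 / c.
  by rewrite /p; field; rewrite gt_eqF.
have -> : q = lambda * `|x| + 2^-1 * z ^+ 2 / c.
  by rewrite /q; field; rewrite gt_eqF.
lra.
Qed.

End SoftThreshold.

(** * [f] as a least-squares function of each block *)

Section Unfoldings.
Context {R : realType} {I J K L : nat} (A : tensor3 R I J K).
Implicit Types (X : 'M[R]_(I, L)) (Y : 'M[R]_(J, L)) (Z : 'M[R]_(K, L))
  (alpha : 'rV[R]_L).

(** Matricizations along the three modes. The column order follows the Kronecker index of the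
    Khatri-Rao products in [matU], [matV] and [matW]. *)
Definition unfold1 : 'M[R]_(I, K * J) :=
  \matrix_(i, l) A (i, (mxtens_unindex l).2, (mxtens_unindex l).1).
Definition unfold2 : 'M[R]_(J, K * I) :=
  \matrix_(j, l) A ((mxtens_unindex l).2, j, (mxtens_unindex l).1).
Definition unfold3 : 'M[R]_(K, J * I) :=
  \matrix_(k, l) A ((mxtens_unindex l).2, (mxtens_unindex l).1, k).

Lemma sum_mxtens_index m n (F : 'I_(m * n) -> R) :
  \sum_l F l = \sum_i \sum_j F (mxtens_index (i, j)).
Proof.
rewrite pair_big /= (reindex (@mxtens_index m n)).
  by apply: eq_bigr => -[i j].
by exists (@mxtens_unindex m n) => l _; rewrite ?mxtens_indexK ?mxtens_unindexK.
Qed.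

Lemma sum_tensor (F : 'I_I * 'I_J * 'I_K -> R) :
  \sum_t F t = \sum_i \sum_j \sum_k F (i, j, k).
Proof.
by rewrite !pair_big; apply: eq_bigr => -[[i j] k].
Qed.

Lemma lrat_fE X Y Z alpha :
  lrat_f A X Y Z alpha = 2^-1 * \sum_i \sum_j \sum_k
    (A (i, j, k) - \sum_r alpha 0 r * X i r * Y j r * Z k r) ^+ 2.
Proof.
rewrite /lrat_f sqr_sqrtr; last by apply: sumr_ge0 => t _; exact: sqr_ge0.
rewrite sum_tensor; congr (_ * _).
apply: eq_bigr => i _; apply: eq_bigr => j _; apply: eq_bigr => k _.
rewrite !ffunE sum_ffunE; congr ((_ - _) ^+ 2); apply: eq_bigr => r _.
by rewrite !ffunE !mxE /GRing.scale /= !mulrA.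
Qed.

Lemma diag_krE m n alpha (P : 'M[R]_(m, L)) (Q : 'M[R]_(n, L)) r i j :
  diag_kr alpha P Q r (mxtens_index (i, j)) = alpha 0 r * (P i r * Q j r).
Proof.
by rewrite /diag_kr mul_diag_mx !mxE mxtens_indexK.
Qed.

(** The first unfolding of the CP tensor is [X *m matU alpha Y Z]; the sums are exchanged because
    [k] is the outer column index. *)
Lemma lrat_f_lsq1 X Y Z alpha :
  lrat_f A X Y Z alpha = lsq unfold1 (matU alpha Y Z) X.
Proof.
rewrite lrat_fE /lsq sqr_fnorm mxdotE; congr (_ * _).
apply: eq_bigr => i _; rewrite sum_mxtens_index exchange_big /=.
apply: eq_bigr => k _; apply: eq_bigr => j _.
rewrite expr2 !mxE !mxtens_indexK /=.
suff -> : \sum_r alpha 0 r * X i r * Y j r * Z k r =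
  \sum_r X i r * matU alpha Y Z r (mxtens_index (k, j)) by [].
by apply: eq_bigr => r _; rewrite diag_krE; ring.
Qed.

Lemma lrat_f_lsq2 X Y Z alpha :
  lrat_f A X Y Z alpha = lsq unfold2 (matV alpha X Z) Y.
Proof.
rewrite lrat_fE /lsq sqr_fnorm mxdotE; congr (_ * _).
rewrite exchange_big /=.
apply: eq_bigr => j _; rewrite sum_mxtens_index exchange_big /=.
apply: eq_bigr => k _; apply: eq_bigr => i _.
rewrite expr2 !mxE !mxtens_indexK /=.
suff -> : \sum_r alpha 0 r * X i r * Y j r * Z k r =
  \sum_r Y j r * matV alpha X Z r (mxtens_index (k, i)) by [].
by apply: eq_bigr => r _; rewrite diag_krE; ring.
Qed.

Lemma lrat_f_lsq3 X Y Z alpha :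
  lrat_f A X Y Z alpha = lsq unfold3 (matW alpha X Y) Z.
Proof.
rewrite lrat_fE /lsq sqr_fnorm mxdotE; congr (_ * _).
under eq_bigr do rewrite exchange_big /=.
rewrite exchange_big /=.
apply: eq_bigr => k _; rewrite sum_mxtens_index exchange_big /=.
apply: eq_bigr => j _; apply: eq_bigr => i _.
rewrite expr2 !mxE !mxtens_indexK /=.
suff -> : \sum_r alpha 0 r * X i r * Y j r * Z k r =
  \sum_r Z k r * matW alpha X Y r (mxtens_index (j, i)) by [].
by apply: eq_bigr => r _; rewrite diag_krE; ring.
Qed.

(** The CP tensor is linear in the weights: its vectorization is [alpha *m matQ X Y Z]. *)
Lemma lrat_f_lsq4 X Y Z alpha :
  lrat_f A X Y Z alpha = lsq (vec_tensor A) (matQ X Y Z) alpha.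
Proof.
rewrite lrat_fE /lsq sqr_fnorm mxdotE big_ord1 !sum_mxtens_index; congr (_ * _).
apply: eq_bigr => i _; apply: eq_bigr => j _; apply: eq_bigr => k _.
rewrite expr2 !mxE !mxtens_indexK /=.
suff -> : \sum_r alpha 0 r * X i r * Y j r * Z k r =
  \sum_r alpha 0 r * matQ X Y Z r (mxtens_index (mxtens_index (i, j), k)) by [].
apply: eq_bigr => r _.
by rewrite !mxE !mxtens_indexK /= !ffunE !mxE /= !mulrA.
Qed.

Lemma Psi_unit_cols (lambda : R) X Y Z alpha :
  unit_cols X -> unit_cols Y -> unit_cols Z ->
  Psi A lambda X Y Z alpha = (lrat_f A X Y Z alpha + lambda * norm1 alpha)%:E.
Proof.
by move=> X1 Y1 Z1; rewrite /Psi !indicator_unit_cols // !adde0 -EFinD.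
Qed.

End Unfoldings.

(** * Feasibility of the iterates and descent of [Psi] *)

Lemma lrat_unit_cols (R : realType) (I J K L : nat) (A : tensor3 R I J K)
    (lambda s : R) (X : nat -> 'M[R]_(I, L)) (Y : nat -> 'M[R]_(J, L))
    (Z : nat -> 'M[R]_(K, L)) (alpha : nat -> 'rV[R]_L)
    (d e f eta : nat -> R) (n : nat) :
  LRAT_sequence A lambda s X Y Z alpha d e f eta ->
  [/\ unit_cols (X n), unit_cols (Y n) & unit_cols (Z n)].
Proof.
(* No induction: every iterate after the first is itself a normalization. *)
move=> lrat; case: n => [|n].
  by split; [exact: lrat_X0 lrat|exact: lrat_Y0 lrat|exact: lrat_Z0 lrat].
split.
- by have [D0 ->] := lrat_X lrat n; exact: normalize_cols_unit.
- by have [D0 ->] := lrat_Y lrat n; exact: normalize_cols_unit.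
- by have [D0 ->] := lrat_Z lrat n; exact: normalize_cols_unit.
Qed.

Theorem lemma4p3 (R : realType) (I J K L : nat) (A : tensor3 R I J K)
    (lambda s : R) (X : nat -> 'M[R]_(I, L)) (Y : nat -> 'M[R]_(J, L))
    (Z : nat -> 'M[R]_(K, L)) (alpha : nat -> 'rV[R]_L)
    (d e f eta : nat -> R) :
  (0 < L)%N -> (tensor_rank A <= L)%N -> 0 < lambda -> 1 < s ->
  LRAT_sequence A lambda s X Y Z alpha d e f eta ->
  forall n : nat,
  [/\ (Psi A lambda (X n) (Y n) (Z n) (alpha n)
         - Psi A lambda (X n.+1) (Y n) (Z n) (alpha n)
       >= (2^-1 * (s - 1) * d n * fnorm (X n - X n.+1) ^+ 2)%:E)%E,
      (Psi A lambda (X n.+1) (Y n) (Z n) (alpha n)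
         - Psi A lambda (X n.+1) (Y n.+1) (Z n) (alpha n)
       >= (2^-1 * (s - 1) * e n * fnorm (Y n - Y n.+1) ^+ 2)%:E)%E,
      (Psi A lambda (X n.+1) (Y n.+1) (Z n) (alpha n)
         - Psi A lambda (X n.+1) (Y n.+1) (Z n.+1) (alpha n)
       >= (2^-1 * (s - 1) * f n * fnorm (Z n - Z n.+1) ^+ 2)%:E)%E
    & (Psi A lambda (X n.+1) (Y n.+1) (Z n.+1) (alpha n)
         - Psi A lambda (X n.+1) (Y n.+1) (Z n.+1) (alpha n.+1)
       >= (2^-1 * (s - 1) * eta n * fnorm (alpha n - alpha n.+1) ^+ 2)%:E)%E].
Proof.
move=> _ _ l0 s1 lrat n.
have [X1 Y1 Z1] := lrat_unit_cols n lrat.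
have [X2 Y2 Z2] := lrat_unit_cols n.+1 lrat.
(* All five points are feasible, so [Psi] is finite there and the claims become real
   inequalities. *)
rewrite !Psi_unit_cols // -!EFinB !lee_fin; split.
- rewrite !lrat_f_lsq1; have [] := lrat_X lrat n.
  (* Rewriting under the gradient makes the update a normalized gradient step for [lsq], whose step
     constant is [d n]. *)
  rewrite (lrat_d lrat) (funext (fun X' => lrat_f_lsq1 A X' _ _ _)) => D0 ->.
  exact: lsq_normalize_descent.
- rewrite !lrat_f_lsq2; have [] := lrat_Y lrat n.
  rewrite (lrat_e lrat) (funext (fun Y' => lrat_f_lsq2 A _ Y' _ _)) => D0 ->.
  exact: lsq_normalize_descent.
- rewrite !lrat_f_lsq3; have [] := lrat_Z lrat n.
  rewrite (lrat_fn lrat) (funext (fun Z' => lrat_f_lsq3 A _ _ Z' _)) => D0 ->.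
  exact: lsq_normalize_descent.
(* In the weight update the l1 term changes, so the two nonsmooth values in [lsq_descent] differ. *)
rewrite !lrat_f_lsq4; have := lrat_alpha lrat n.
rewrite (lrat_eta lrat) (funext (lrat_f_lsq4 A _ _ _)) => /= ->.
apply: lsq_descent; apply: soft_threshold_norm1 => //.
by rewrite mulr_gt0 ?step_const_gt0 ?(lt_trans ltr01).
Qed.
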